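(* Let $n$ and $k$ be integers with $2\le k\le n-3$, and let $\Gamma$ be a connected simple graph of order $n$ with exactly $k$ bridges. Then \[ SO(\Gamma)\ge 2(n-4)\sqrt{2}+\sqrt{5}+3\sqrt{13}, \] with equality if and only if $\Gamma\cong \mathbb{P}_n^k$.
   Context: The Sombor index of a graph $\Gamma$ is $SO(\Gamma)=\sum_{uv\in E(\Gamma)}\sqrt{\deg_\Gamma(u)^2+\deg_\Gamma(v)^2}$. A bridge is an edge whose deletion disconnects the graph. $\mathbb{P}_n^k$ is the graph obtained from the cycle $C_{n-k}$ by taking a vertex $u_1$ of the cycle and attaching a path on $k+1$ vertices to it (identifying one end vertex of the path with $u_1$), thereby adding $k$ new vertices. *)

(* Defs.v *)
From mathcomp Require Import all_boot all_order all_algebra.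

Set Implicit Arguments.
Unset Strict Implicit.
Unset Printing Implicit Defensive.

Import GRing.Theory.

(* A simple graph is a symmetric irreflexive relation on a finType. *)

Section Graphs.
Variables (T : finType) (e : rel T).

Definition edges : {set {set T}} := [set [set x; y] | x in T, y in T & e x y].

Definition deg (x : T) : nat := #|[set y | e x y]|.

Definition connected : bool := [forall x, forall y, connect e x y].

Definition del_edge (A : {set T}) : rel T :=
  [rel x y | e x y && ([set x; y] != A)].

End Graphs.

(* "The deletion of A disconnects the graph": meant for a connected e. *)
Definition bridges (T : finType) (e : rel T) : {set {set T}} :=
  [set A in edges e | ~~ connected (del_edge e A)].

(* An edge is a two-element set A = {u, v}, so the inner sum is
   deg(u)^2 + deg(v)^2. *)
Definition sombor (R : rcfType) (T : finType) (e : rel T) : R :=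
  (\sum_(A in edges e) Num.sqrt (\sum_(u in A) (deg e u)%:R ^+ 2))%R.

Definition graph_iso (T U : finType) (e : rel T) (f : rel U) : Prop :=
  exists2 h : T -> U, bijective h & forall x y, f (h x) (h y) = e x y.

(* P_n^k on the vertices 0, ..., n-1 : the vertices 0, ..., n-k-1 form the
   cycle C_{n-k}, u_1 is the vertex 0, and 0, n-k, n-k+1, ..., n-1 is the
   attached path on k+1 vertices. *)
Definition Pnk_arc (n k i j : nat) : bool :=
  ((i < n - k) && (j == i.+1 %% (n - k)))
  || ((n - k <= j) && (i == if j == n - k then 0 else j.-1)).

Definition Pnk (n k : nat) : rel 'I_n :=
  [rel i j : 'I_n | Pnk_arc n k i j || Pnk_arc n k j i].

Lemma Pnk_sym n k : symmetric (@Pnk n k).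
Proof. by move=> i j; rewrite /Pnk /= orbC. Qed.

Lemma Pnk_irr n k : k + 3 <= n -> irreflexive (@Pnk n k).
Proof.
move=> le_kn i; rewrite /Pnk /= orbb /Pnk_arc.
have lt2 : 2 < n - k by rewrite ltn_subRL -addnS.
apply/negbTE; rewrite negb_or; apply/andP; split.
  apply/negP => /andP[lt_i /eqP]; have [Ei|neq_i] := eqVneq i.+1 (n - k).
    by rewrite Ei modnn => i0; move: lt2; rewrite -Ei i0.
  by rewrite modn_small => [/n_Sn //|]; rewrite ltn_neqAle neq_i lt_i.
apply/negP => /andP[le_i /eqP]; case: eqP => [eq_i i0|_ Ei].
  by move: lt2; rewrite -eq_i i0.
have: 0 < i by apply: leq_trans le_i; apply: leq_trans lt2.
by case: (nat_of_ord i) Ei => // m /= /esym/n_Sn.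
Qed.

(* Main.v *)
Require Import Defs.
From mathcomp Require Import all_boot all_order all_algebra.
From mathcomp Require Import zify ring lra.

(**
Write [m] for the number of edges and [mu = 2 (2 sqrt 2 - sqrt 5)].  Give an edge
with end degrees [a] and [b] the weight
[sqrt (a^2 + b^2) - 2 sqrt 2 - mu (1 - 1/a - 1/b)]; the constant [mu] is chosen so
that the weights of (1,2) and (2,2) vanish.  Since the sum of [1/a + 1/b] over the
edges is [n], the Sombor index is the total weight plus
[2 n sqrt 2 + (2 sqrt 2 + mu) (m - n)].  A graph with fewer than [n - 1] bridges has
a non-bridge, whose deletion leaves a connected graph, so [m >= n]; and since the
graph has a bridge, it is not 2-regular, so some vertex [x] has degree at least 3.
An edge at a vertex of degree at least 3 weighs at least as much as a (3,2) edge,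
with equality only for (3,2), and no edge has negative weight: the three edges at
[x] already give the bound.  Equality forces [x] to be the only vertex of degree
above 2, with degree 3 and neighbours of degree 2, and leaves exactly one leaf.  A
longest path from that leaf must then be Hamiltonian, with its last vertex adjacent
to [x]; the bridges are exactly the edges of the path between the leaf and [x].
*)

Import Order.TTheory GRing.Theory Num.Theory.

(** * Edge counts and bridges *)

Section Counting.
Context {T : finType} (e : rel T).

Lemma mem_edges x y : e x y -> [set x; y] \in edges e.
Proof. by move=> exy; apply/imset2P; exists x y; rewrite ?inE. Qed.

Lemma edgesP A : reflect (exists x y, e x y /\ A = [set x; y]) (A \in edges e).
Proof.
apply: (iffP imset2P) => [[x y _]|[x [y [exy ->]]]].
  by rewrite inE => exy ->; exists x, y.
by exists x y; rewrite ?inE.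
Qed.

Lemma eq_set2 (a b c d : T) :
  ([set a; b] == [set c; d]) = ((a == c) && (b == d)) || ((a == d) && (b == c)).
Proof.
apply/eqP/idP => [E|/orP[]/andP[/eqP-> /eqP->] //]; last by rewrite setUC.
have aE : a \in [set c; d] by rewrite -E set21.
have bE : b \in [set c; d] by rewrite -E set22.
have cE : c \in [set a; b] by rewrite E set21.
have dE : d \in [set a; b] by rewrite E set22.
move: aE bE cE dE; rewrite !inE ![c == _]eq_sym ![d == _]eq_sym.
by do 4![case: eqP => ? //=]; subst; rewrite ?eqxx.
Qed.

Hypotheses (e_sym : symmetric e) (e_irr : irreflexive e).

(** Each edge comes from exactly two ordered pairs. An arbitrary commutative law lets the lemma
    serve degree sums in [nat] and Sombor sums in a field. *)
Lemma big_arcs (R : Type) (idx : R) (op : Monoid.com_law idx) (H : {set T} -> R) :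
  \big[op/idx]_x \big[op/idx]_(y | e x y) H [set x; y]
  = \big[op/idx]_(A in edges e) op (H A) (H A).
Proof.
rewrite pair_big_dep /=.
rewrite (partition_big (fun p : T * T => [set p.1; p.2]) (mem (edges e))) /=;
  last by move=> p; apply: mem_edges.
apply: eq_bigr => A /edgesP[a [b [eab ->]]].
have neq : (b, a) != (a, b).
  by apply: contraTneq eab => -[-> _]; rewrite e_irr.
rewrite (bigD1 (a, b)) /=; last by rewrite eab eqxx.
rewrite (bigD1 (b, a)) /=; last by rewrite e_sym eab setUC eqxx neq.
rewrite big_pred0 ?Monoid.mulm1; first by rewrite [[set b; a]]setUC.
move=> [c d] /=; rewrite eq_set2 !xpair_eqE.
by case: (c == a) (d == b) (c == b) (d == a) => [] [] [] []; rewrite ?andbF.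
Qed.

Lemma degE x : deg e x = \sum_(y | e x y) 1.
Proof. by rewrite /deg -sum1_card; apply: eq_bigl => y; rewrite inE. Qed.

Lemma handshake : \sum_x deg e x = (#|edges e|).*2.
Proof.
under eq_bigr => x _ do rewrite degE.
by rewrite (big_arcs _ _ addn (fun=> 1)) sum_nat_const muln2.
Qed.

Lemma double_edges_le n m x : #|T| = n -> #|edges e| = m ->
  (forall y, y != x -> deg e y <= 2) -> m.*2 + 2 <= deg e x + n.*2.
Proof.
move=> <- <- dle; rewrite -handshake (bigD1 x) //= -addnA leq_add2l.
rewrite -muln2 -sum_nat_const [leqRHS](bigD1 x) //= addnC leq_add2l.
exact: leq_sum.
Qed.

Hypothesis e_conn : connected e.

Lemma connected_closed (S : {set T}) x :
  x \in S -> (forall a b, a \in S -> e a b -> b \in S) -> S = setT.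
Proof.
move=> xS clS; apply/setP => y; rewrite inE.
have /forallP/(_ x)/forallP/(_ y) : connected e by [].
case/connectP => p; elim: p x xS => [|z p IHp] x xS /=; first by move=> _ ->.
by case/andP => exz /IHp; apply; apply: clS exz.
Qed.

Lemma deg_gt0 x : 1 < #|T| -> 0 < deg e x.
Proof.
move=> T1; rewrite lt0n; apply: contraTneq T1 => /cards0_eq d0.
rewrite -cardsT -(connected_closed [set x] x) ?set11 ?cards1 //.
by move=> a b /set1P -> exb; have := in_set0 b; rewrite -d0 inE exb.
Qed.

End Counting.

(** A vertex set is grown one vertex at a time. By connectedness an edge leaves the set as long as
    it is not everything, and each added vertex brings a new edge inside the set. *)
Lemma connected_card_edges {T : finType} (e : rel T) :
  connected e -> #|T| <= #|edges e|.+1.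
Proof.
move=> e_conn; have [->//|[r _]] : #|T| = 0 \/ exists r : T, true.
  by case: (pickP T) => [r _|/eq_card0]; [right; exists r | left].
suff [S cS qS] : exists2 S : {set T},
    #|S| = #|T| & #|T| <= #|[set A in edges e | A \subset S]|.+1.
  by apply: leq_trans qS _; rewrite ltnS subset_leq_card // setIdE subsetIl.
have grow m : 0 < m <= #|T| -> exists2 S : {set T},
    #|S| = m & m <= #|[set A in edges e | A \subset S]|.+1.
  elim: m => // -[_ _|m IHm m2]; first by exists [set r]; rewrite ?cards1.
  have [|S cS qS] := IHm; first by lia.
  have [/existsP[x /existsP[y /and3P[xS exy yS]]]|] :=
      boolP [exists x, exists y, [&& x \in S, e x y & y \notin S]].
    exists (y |: S); first by rewrite cardsU1 yS cS.
    rewrite ltnS; apply: leq_trans qS _.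
    have nA : [set x; y] \notin [set A in edges e | A \subset S].
      by rewrite inE subUset !sub1set (negPf yS) !andbF.
    have := cardsU1 [set x; y] [set A in edges e | A \subset S].
    rewrite nA add1n => <-; apply/subset_leq_card/subsetP => A.
    rewrite !inE => /orP[/eqP->|/andP[-> AS]].
      rewrite mem_edges //; apply/subsetP => z; rewrite !inE.
      by case/orP=> /eqP->; rewrite ?eqxx ?xS ?orbT.
    exact: subset_trans AS (subsetUr _ _).
  rewrite negb_exists => /forallP noexit.
  have /card_gt0P[x xS] : 0 < #|S| by rewrite cS.
  have ST : S = setT.
    apply: (connected_closed e e_conn S x xS) => a b aS eab.
    have := noexit a; rewrite negb_exists => /forallP/(_ b).
    by rewrite aS eab /= negbK.
  by move: m2; rewrite -cS ST cardsT; lia.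
by apply: grow; rewrite leqnn andbT; apply/card_gt0P; exists r.
Qed.

(** * Edge deletion, bridges and vertices of degree at least 3 *)

Section Bridges.
Context {T : finType} (e : rel T).
Hypotheses (e_sym : symmetric e) (e_irr : irreflexive e).
Hypothesis e_conn : connected e.

Lemma del_edge_sym A : symmetric (del_edge e A).
Proof. by move=> x y; rewrite /del_edge /= e_sym setUC. Qed.

Lemma del_edge_irr A : irreflexive (del_edge e A).
Proof. by move=> x; rewrite /del_edge /= e_irr. Qed.

Lemma edges_del_edge A : edges (del_edge e A) = edges e :\ A.
Proof.
apply/setP => B; rewrite !inE; apply/edgesP/andP.
  by case=> x [y [/andP[exy nA] ->]]; rewrite nA mem_edges.
case=> nBA /edgesP[x [y [exy eB]]]; exists x, y; split=> //.
by rewrite /del_edge /= exy -eB.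
Qed.

(** A connected graph has at least [#|T| - 1] edges, so some edge is not a bridge; what is left
    after its deletion is connected and obeys the same bound with one edge fewer. *)
Lemma card_edges_ge : #|bridges e|.+1 < #|T| -> #|T| <= #|edges e|.
Proof.
move=> kn; have mn := connected_card_edges e e_conn.
have : bridges e \proper edges e.
  rewrite properEcard; apply/andP; split; last by lia.
  by apply/subsetP => A; rewrite inE => /andP[].
case/properP => _ [A Ae]; rewrite inE Ae /= negbK => /connected_card_edges.
by rewrite edges_del_edge (cardsD1 A (edges e)) Ae.
Qed.

(* Deleting a bridge xy from a 2-regular graph leaves x in a component with one
   odd degree, against the handshake lemma. *)
Lemma two_regular_no_bridge : (forall x, deg e x = 2) -> bridges e = set0.
Proof.
move=> d2; apply/setP => A; rewrite in_set0; apply/negP.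
rewrite inE => /andP[/edgesP[x [y [exy eA]]] /negP]; apply.
pose f := del_edge e A.
have f_sym : symmetric f := del_edge_sym A.
have csym : connect_sym f := sym_connect_sym f_sym.
have dxy : x != y by apply: contraTneq exy => ->; rewrite e_irr.
suff fxy : connect f x y.
  apply/forallP => a; apply/forallP => b.
  have /forallP/(_ a)/forallP/(_ b) := e_conn.
  apply: connect_sub => c d ecd; have [E|ncd] := eqVneq [set c; d] A.
    have : [set c; d] == [set x; y] by rewrite E eA.
    by rewrite eq_set2 => /orP[]/andP[/eqP-> /eqP->] //; move: fxy; rewrite csym.
  by apply: connect1; apply/andP.
apply/negPn/negP => nfxy.
pose C := [pred z | connect f x z].
(* [g] keeps the edges of [f] inside the component [C] of [x]; it is symmetric because no edge of
   [f] leaves [C]. Its degrees sum to [2 * #|C| - 1], which is odd. *)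
pose g a b := f a b && (a \in C).
have g_sym : symmetric g.
  move=> a b; rewrite /g f_sym; have [fba|] //= := boolP (f b a).
  by rewrite !inE; apply/esym/(same_connect_r csym)/connect1.
have g_irr : irreflexive g by move=> a; rewrite /g /f del_edge_irr.
have := handshake g g_sym g_irr.
have dg z : deg g z = (z \in C) * 2 - (z == x).
  have [zC|zC] := boolP (z \in C); last first.
    rewrite mul0n sub0n; apply/eqP; rewrite cards_eq0; apply/eqP/setP => b.
    by rewrite in_set in_set0 /g (negPf zC) andbF.
  have -> : deg g z = #|[set b | e z b] :\: [set b | [set z; b] == A]|.
    by apply: eq_card => b; rewrite in_set /g zC andbT in_setD !in_set andbC.
  have [->|zx] := eqVneq z x.
    have -> : [set b | [set x; b] == A] = [set y].
      apply/setP => b; rewrite !inE eA eq_set2 eqxx /=.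
      by rewrite (negPf dxy) orbF.
    have := cardsD1 y [set b | e x b]; rewrite inE exy.
    by have := d2 x; rewrite /deg; lia.
  have -> : [set b | [set z; b] == A] = set0.
    apply/setP => b; rewrite !inE eA eq_set2 (negPf zx) /=.
    apply: contraNF nfxy => /andP[/eqP<- _]; exact: zC.
  by rewrite setD0 subn0 mul1n; apply: d2.
have : \sum_z deg g z + 1 = \sum_(z in C) 2.
  rewrite (bigD1 x) //= [in RHS](bigD1 x) /=; last exact: connect0.
  rewrite dg eqxx inE connect0 /= -addnA [_ + 1]addnC addnA; congr addn.
  rewrite [in RHS]big_mkcondl /=; apply: eq_bigr => z zx.
  by rewrite dg (negPf zx) subn0; case: (z \in C).
by rewrite sum_nat_const => E1 E2; lia.
Qed.

(** If all degrees were at most 2, having at least as many edges as vertices would force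
    2-regularity, and then there would be no bridge. *)
Lemma exists_deg_ge3 :
  #|T| <= #|edges e| -> bridges e != set0 -> exists x, 2 < deg e x.
Proof.
move=> nm; have [[x x3] _|no3] := altP (@existsP _ (fun x => 2 < deg e x)).
  by exists x.
have d_le x : deg e x <= 2 by rewrite leqNgt; apply: contra no3 => ?; apply/existsP; exists x.
case/negP; apply/eqP/two_regular_no_bridge => x; apply/eqP; rewrite eqn_leq d_le /=.
rewrite leqNgt; apply/negP => x2.
have := double_edges_le e e_sym e_irr _ _ x erefl erefl (fun y _ => d_le y).
by move: nm; rewrite -leq_double; lia.
Qed.

End Bridges.

(** * Edge weights *)

Section Weight.
Local Open Scope ring_scope.
Context {R : rcfType}.

Lemma sqrt_between (a b c : R) :
  0 <= a -> a ^+ 2 < c -> 0 <= b -> c < b ^+ 2 -> a < Num.sqrt c < b.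
Proof.
move=> a0 ac b0 cb; have c0 : 0 < c by apply: le_lt_trans ac; apply: sqr_ge0.
apply/andP; split.
  by rewrite -(ger0_norm a0) -sqrtr_sqr ltr_sqrt.
by rewrite -(ger0_norm b0) -sqrtr_sqr ltr_sqrt // (lt_trans c0 cb).
Qed.

(** In this and the next two lemmas the bounds are consecutive continued fraction convergents, tight
    enough for the linear comparisons of weights. *)
Lemma sqrt2_bounds : 41 / 29 < (Num.sqrt 2 : R) < 99 / 70.
Proof. by apply: sqrt_between; lra. Qed.

Lemma sqrt5_bounds : 38 / 17 < (Num.sqrt 5 : R) < 161 / 72.
Proof. by apply: sqrt_between; lra. Qed.

Lemma sqrt13_bounds : 18 / 5 < (Num.sqrt 13 : R) < 119 / 33.
Proof. by apply: sqrt_between; lra. Qed.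

Definition mu : R := 2 * (2 * Num.sqrt 2 - Num.sqrt 5).

Definition weight (a b : nat) : R :=
  Num.sqrt (a%:R ^+ 2 + b%:R ^+ 2) - 2 * Num.sqrt 2 - mu * (1 - a%:R^-1 - b%:R^-1).

Lemma weightC a b : weight a b = weight b a.
Proof. by rewrite /weight [X in Num.sqrt X]addrC; ring. Qed.

Lemma weight12 : weight 1 2 = 0.
Proof.
rewrite /weight /mu (_ : 1%:R ^+ 2 + 2%:R ^+ 2 = 5); last by ring.
by field.
Qed.

Lemma weight22 : weight 2 2 = 0.
Proof.
rewrite /weight /mu (_ : 2%:R ^+ 2 + 2%:R ^+ 2 = 2 ^+ 2 * 2); last by ring.
by rewrite sqrtrM ?sqr_ge0 // sqrtr_sqr ger0_norm //; field.
Qed.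

Lemma weight32 : weight 3 2 = Num.sqrt 13 - 2 * Num.sqrt 2 - mu / 6.
Proof.
rewrite /weight (_ : 3%:R ^+ 2 + 2%:R ^+ 2 = 13); last by ring.
by field.
Qed.

Lemma weight32_gt0 : 0 < weight 3 2.
Proof.
rewrite weight32 /mu.
have := sqrt2_bounds; have := sqrt5_bounds; have := sqrt13_bounds; lra.
Qed.

(** Replaces the square root and the two inverses by lower bounds [c], [u], [v], using [0 < mu].
    What remains is linear in the roots of 2, 5 and 13. The constant is [5 / 6 = 1 / 3 + 1 / 2],
    from the (3,2) edge. *)
Lemma weight_gt a b (c u v : R) :
  0 <= c -> c ^+ 2 <= a%:R ^+ 2 + b%:R ^+ 2 -> u <= a%:R^-1 -> v <= b%:R^-1 ->
  Num.sqrt 13 + mu * (5 / 6 - u - v) < c -> weight 3 2 < weight a b.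
Proof.
move=> c0 cle ua vb h; rewrite weight32 /weight.
have : c <= Num.sqrt (a%:R ^+ 2 + b%:R ^+ 2).
  by rewrite -{1}(ger0_norm c0) -sqrtr_sqr ler_wsqrtr.
have mu0 : 0 < mu by rewrite /mu; have := sqrt2_bounds; have := sqrt5_bounds; lra.
have := ler_wpM2l (ltW mu0) ua; have := ler_wpM2l (ltW mu0) vb; lra.
Qed.

Lemma weight_lt a b : (2 < a)%N -> (0 < b)%N ->
  (a, b) != (3, 2)%N -> weight 3 2 < weight a b.
Proof.
move=> a3 b0 nab.
have s2 := sqrt2_bounds; have s5 := sqrt5_bounds; have s13 := sqrt13_bounds.
have inv0 (d : nat) : (0 : R) <= d%:R^-1 by rewrite invr_ge0.
have sq (c d : nat) : (c <= d)%N -> c%:R ^+ 2 <= (d%:R : R) ^+ 2.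
  by move=> cd; rewrite lerXn2r ?nnegrE ?ler_nat.
have [a4|a4] := leqP 4 a; have sa := sq _ _ a3; last first.
  have {a3 a4} ea : a = 3 by lia.
  rewrite ea in nab sa *.
  case: b b0 nab => [|[|[|[|b]]]] // _ _.
  (* The rationals lie just below the square roots of 10 and 18; for [b >= 4] the 3-4-5 triangle
     gives [c = 5], large enough to drop both inverses. *)
  - apply: (@weight_gt _ _ (79 / 25) (1 / 3) 1); rewrite /mu; lra.
  - apply: (@weight_gt _ _ (21 / 5) (1 / 3) (1 / 3)); rewrite /mu; lra.
  - have sb : 4%:R ^+ 2 <= (b.+4%:R : R) ^+ 2 by apply: sq.
    apply: (@weight_gt _ _ 5 0 0); rewrite /mu ?inv0 //; lra.
have {}sa := sq _ _ a4.
case: b b0 nab => [|[|[|b]]] // _ _.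
(* With [a >= 4] the bounds come from 17, 20 and 25, and [1 / a] is only bounded by 0. *)
- apply: (@weight_gt _ _ 4 0 1); rewrite /mu ?inv0 //; lra.
- apply: (@weight_gt _ _ (22 / 5) 0 (1 / 2)); rewrite /mu ?inv0 //; lra.
- have sb : 3%:R ^+ 2 <= (b.+3%:R : R) ^+ 2 by apply: sq.
  apply: (@weight_gt _ _ 5 0 0); rewrite /mu ?inv0 //; lra.
Qed.

Lemma weight_ge a b : (2 < a)%N -> (0 < b)%N -> weight 3 2 <= weight a b.
Proof.
move=> a3 b0; have [[-> ->]//|/weight_lt h] := eqVneq (a, b) (3, 2)%N.
exact/ltW/h.
Qed.

Lemma weight_le2 a b : (0 < a <= 2)%N -> (0 < b <= 2)%N -> (a, b) != (1, 1)%N ->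
  weight a b = 0.
Proof.
case: a b => [|[|[|a]]] [|[|[|b]]] // _ _ _; rewrite ?weight12 ?weight22 //.
by rewrite weightC weight12.
Qed.

End Weight.

(** * The lower bound and its equality case *)

Section Sombor.
Local Open Scope ring_scope.
Context (R : rcfType) {T : finType} (e : rel T).
Hypotheses (e_sym : symmetric e) (e_irr : irreflexive e).

Lemma sum_arcs_const (c : R) x : \sum_(y | e x y) c = (deg e x)%:R * c.
Proof.
by rewrite sumr_const mulr_natl; congr (_ *+ _); apply: eq_card => y; rewrite !inE.
Qed.

Lemma sombor_arcs :
  \sum_x \sum_(y | e x y) Num.sqrt ((deg e x)%:R ^+ 2 + (deg e y)%:R ^+ 2)
  = 2 * sombor R e.
Proof.
pose H (A : {set T}) : R := Num.sqrt (\sum_(u in A) (deg e u)%:R ^+ 2).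
transitivity (\sum_x \sum_(y | e x y) H [set x; y]).
  apply: eq_bigr => x _; apply: eq_bigr => y exy; congr Num.sqrt.
  rewrite big_setU1 ?big_set1 // inE.
  by apply: contraTneq exy => ->; rewrite e_irr.
rewrite (big_arcs e e_sym e_irr _ _ +%R) /sombor mulr_sumr.
by apply: eq_bigr => A _; rewrite /H /= mulr_natl mulr2n.
Qed.

(** Sums run over ordered pairs, which doubles every term. Summed over the pairs starting at [x],
    the inverse of [deg e x] gives 1, so either family of inverses totals [n]. *)
Lemma sombor_weight n m : #|T| = n -> #|edges e| = m ->
  (forall x, (0 < deg e x)%N) ->
  2 * sombor R e = \sum_x \sum_(y | e x y) weight (deg e x) (deg e y)
    + 4 * n%:R * Num.sqrt 2 + (2 * Num.sqrt 2 + mu) * (2 * m%:R - 2 * n%:R).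
Proof.
move=> <- <- d_gt0.
have inv_sum : \sum_x \sum_(y | e x y) (deg e x)%:R^-1 = #|T|%:R :> R.
  under eq_bigr => x _ do rewrite sum_arcs_const mulfV ?pnatr_eq0 -?lt0n //.
  by rewrite sumr_const.
have inv_sumC : \sum_x \sum_(y | e x y) (deg e y)%:R^-1 = #|T|%:R :> R.
  rewrite -inv_sum (exchange_big_dep xpredT) //=.
  by apply: eq_bigr => y _; apply: eq_bigl => x; rewrite e_sym.
have const_sum (c : R) : \sum_x \sum_(y | e x y) c = 2 * #|edges e|%:R * c.
  under eq_bigr => x _ do rewrite sum_arcs_const.
  by rewrite -mulr_suml -natr_sum handshake // -muln2 natrM [2 * _]mulrC.
have -> : \sum_x \sum_(y | e x y) weight (deg e x) (deg e y) =
  \sum_x \sum_(y | e x y) Num.sqrt ((deg e x)%:R ^+ 2 + (deg e y)%:R ^+ 2)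
  + \sum_x \sum_(y | e x y) (- (2 * Num.sqrt 2 + mu))
  + mu * (\sum_x \sum_(y | e x y) (deg e x)%:R^-1)
  + mu * (\sum_x \sum_(y | e x y) (deg e y)%:R^-1) :> R.
  rewrite !mulr_sumr -!big_split; apply: eq_bigr => x _.
  rewrite !mulr_sumr -!big_split; apply: eq_bigr => y _.
  by rewrite /weight /=; ring.
by rewrite sombor_arcs inv_sum inv_sumC const_sum; ring.
Qed.

Hypothesis e_conn : connected e.

(** A (1,1) edge would have the negative weight [3 sqrt 2 - 2 sqrt 5]. Its two ends would form a
    closed set, hence the whole graph, leaving no room for [x]. *)
Lemma no_isolated_edge x : (2 < deg e x)%N ->
  forall a b, e a b -> (deg e a, deg e b) != (1, 1)%N.
Proof.
move=> x3 a b eab; apply/eqP => -[da db].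
have nbr c d : e c d -> deg e c = 1%N -> [set y | e c y] = [set d].
  move=> ecd dc; apply/esym/eqP; rewrite eqEcard cards1 -/(deg e c) dc leqnn andbT.
  by rewrite sub1set inE.
have Na := nbr _ _ eab da; have Nb : [set y | e b y] = [set a].
  by apply: nbr db; rewrite e_sym.
have : x \in [set a; b].
  rewrite (connected_closed e e_conn [set a; b] a (set21 _ _)) ?inE //.
  move=> c d /set2P[]-> ecd; apply/set2P.
    by right; apply/set1P; rewrite -Na inE.
  by left; apply/set1P; rewrite -Nb inE.
by case/set2P => xE; move: x3; rewrite xE ?da ?db.
Qed.

(** The pairs involving [x] are counted from both ends, hence the factor 2; the remaining sum runs
    over the edges that avoid [x]. *)
Lemma sum_arcs_split (F : T -> T -> R) x : (forall a b, F a b = F b a) ->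
  \sum_a \sum_(b | e a b) F a b =
  2 * (\sum_(b | e x b) F x b)
  + \sum_(a | a != x) \sum_(b | e a b && (b != x)) F a b.
Proof.
move=> FC; rewrite (bigD1 x) //= mulr_natl mulr2n -addrA; congr (_ + _).
have -> : \sum_(b | e x b) F x b = \sum_(a | a != x) (if e a x then F a x else 0).
  rewrite -big_mkcondr; apply: eq_big => [b|b _]; last exact: FC.
  rewrite e_sym; case: eqP => [->|_]; first by rewrite e_irr.
  by rewrite ?andbT.
rewrite -big_split; apply: eq_bigr => a ax /=.
have [eax|neax] := boolP (e a x); first by rewrite (bigD1 x).
rewrite add0r; apply: eq_bigl => b.
by case: (eqVneq b x) => [->|_]; rewrite ?andbT // (negPf neax).
Qed.

Lemma sombor_bound n m x : #|T| = n -> #|edges e| = m -> (n <= m)%N ->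
  (2 < deg e x)%N ->
  let v := 2 * (n%:R - 4) * Num.sqrt 2 + Num.sqrt 5 + 3 * Num.sqrt 13 in
  v <= sombor R e /\
  (sombor R e = v <-> [/\ deg e x = 3%N, forall y, e x y -> deg e y = 2%N
     & forall z, z != x -> (deg e z <= 2)%N]).
Proof.
move=> cT cE nm x3 v.
have T1 : (1 < #|T|)%N.
  by apply: leq_trans (max_card (mem [set y | e x y])); apply: ltnW.
have d_gt0 y := deg_gt0 e e_conn y T1.
have not11 := no_isolated_edge x x3.
have SO := sombor_weight n m cT cE d_gt0.
have w32 := @weight32_gt0 R.
pose W a b : R := weight (deg e a) (deg e b).
have W_ge0 a b : e a b -> 0 <= W a b.
  move=> eab; have [a2|a3] := leqP (deg e a) 2; last first.
    by apply: ltW; apply: lt_le_trans w32 _; apply: weight_ge.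
  have [b2|b3] := leqP (deg e b) 2; last first.
    by rewrite /W weightC; apply: ltW; apply: lt_le_trans w32 _; apply: weight_ge.
  by rewrite /W weight_le2 ?d_gt0 ?not11.
have WC a b : W a b = W b a by apply: weightC.
rewrite (sum_arcs_split W x WC) in SO.
set P := \sum_(b | e x b) W x b in SO.
set Q := \sum_(a | a != x) _ in SO.
have Q_ge0 : 0 <= Q.
  by apply: sumr_ge0 => a _; apply: sumr_ge0 => b /andP[eab _]; apply: W_ge0.
have W_ge b : e x b -> weight 3 2 <= W x b by move=> exb; apply: weight_ge.
have P_ge : (deg e x)%:R * weight 3 2 <= P.
  by rewrite -sum_arcs_const; apply: ler_sum.
have P_ge3 : 3 * weight 3 2 <= P.
  by apply: le_trans P_ge; rewrite ler_pM2r // ler_nat.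
have mn : (n%:R : R) <= m%:R by rewrite ler_nat.
have s2 := @sqrt2_bounds R; have s5 := @sqrt5_bounds R.
have s13 := @sqrt13_bounds R.
have c_gt0 : 0 < 2 * Num.sqrt 2 + mu :> R by rewrite /mu; lra.
(* Hence [sombor R e - v] is the sum of [P - 3 * weight 3 2], [Q / 2] and half of the excess term
   below, all nonnegative; equality makes each of them vanish. *)
have vE : v = 2 * n%:R * Num.sqrt 2 + 3 * weight 3 2.
  by rewrite /v weight32 /mu; field.
have excess_ge0 : 0 <= (2 * Num.sqrt 2 + mu) * (2 * m%:R - 2 * n%:R) :> R.
  by apply: mulr_ge0; lra.
split; first by rewrite vE; lra.
split=> [SOv|[dx dN dO]].
  have P_eq : P = 3 * weight 3 2 by lra.
  have Q_eq : Q = 0 by lra.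
  have dx : deg e x = 3%N.
    apply/eqP; rewrite eqn_leq x3 andbT -(ler_nat R) -(ler_pM2r w32).
    by rewrite -P_eq.
  have dN y : e x y -> deg e y = 2%N.
    move=> exy; apply/eqP/negPn/negP => y2.
    have : weight 3 2 < W x y.
      by apply: weight_lt => //; rewrite xpair_eqE (negPf y2) andbF.
    have : \sum_(b | e x b && (b != y)) (weight 3 2 : R)
        <= \sum_(b | e x b && (b != y)) W x b.
      by apply: ler_sum => b /andP[]/W_ge.
    have := sum_arcs_const (weight 3 2) x; rewrite dx (bigD1 y) //= => E1.
    by move: P_eq; rewrite /P (bigD1 y) //=; lra.
  split=> // z zx; rewrite leqNgt; apply/negP => z3.
  have [/card_gt0P[y]] : (0 < deg e z)%N by [].
  rewrite inE => ezy.
  (* All neighbours of [x] have degree 2, so [z] is not one of them. The edge from [z] to [y]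
     therefore avoids [x] and contributes a positive weight to [Q]. *)
  have yx : y != x.
    by apply: contraTneq ezy => ->; apply/negP; rewrite e_sym => /dN dz; rewrite dz in z3.
  have : 0 < Q; last by rewrite Q_eq ltxx.
  rewrite /Q (bigD1 z) //= (bigD1 y) ?ezy //= -addrA ltr_wpDr //.
    rewrite addr_ge0 ?sumr_ge0 // => [b /andP[/andP[eab _] _]|a _]; first exact: W_ge0.
    by apply: sumr_ge0 => b /andP[eab _]; apply: W_ge0.
  by apply: lt_le_trans w32 _; apply: weight_ge.
have mn_eq : m = n.
  have h := double_edges_le e e_sym e_irr n m x cT cE dO; rewrite dx in h.
  by clear -h nm; lia.
have P_eq : P = 3 * weight 3 2.
  rewrite /P (eq_bigr (fun=> weight 3 2)) ?sum_arcs_const ?dx // => b exb.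
  by rewrite /W dx dN.
have Q_eq : Q = 0.
  apply: big1 => a ax; apply: big1 => b /andP[eab bx].
  by rewrite /W weight_le2 ?d_gt0 ?dO ?not11.
by rewrite vE; move: SO; rewrite P_eq Q_eq mn_eq; lra.
Qed.

End Sombor.

(** * Lassos *)

(* Neighbours of [a] in the lasso obtained from the path 0, 1, ..., n-1 by adding
   the edge between [k] and [n-1]. *)
Definition lasso_nbrs (n k a : nat) : seq nat :=
  if a == 0 then [:: 1]
  else if a == k then [:: k.-1; k.+1; n.-1]
  else if a == n.-1 then [:: n.-2; k]
  else [:: a.-1; a.+1].

(** For [0 < k] the tail runs from the leaf [w 0] to [w k], and the cycle from [w k] to [w n.-1] and
    back. Numbering by [nat] keeps index arithmetic within reach of [lia]; values of [w] from [n] on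
    are irrelevant. *)
Definition lasso {T : finType} (e : rel T) (n k : nat) (w : nat -> T) : Prop :=
  [/\ {in gtn n &, injective w}, forall y, exists2 a, a < n & y = w a
    & {in gtn n &, forall a b, e (w a) (w b) = (b \in lasso_nbrs n k a)}].

(** The degree sum is even and at least [2 * #|T|], while [x] exceeds 2 by one. Two leaves would
    make it too small, and no leaf would make it the odd number [2 * #|T| + 1]. *)
Lemma deg_exists_leaf {T : finType} (e : rel T) x :
  symmetric e -> irreflexive e -> connected e -> #|T| <= #|edges e| ->
  deg e x = 3 -> (forall z, z != x -> deg e z <= 2) ->
  exists v, deg e v = 1 /\ forall y, y != v -> 1 < deg e y.
Proof.
move=> e_sym e_irr e_conn nm dx dO.
have T1 : 1 < #|T|.
  by apply: leq_trans (max_card (mem [set y | e x y])); rewrite -/(deg e x) dx.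
have d_gt0 y := deg_gt0 e e_conn y T1.
have hs := handshake e e_sym e_irr.
have c2 : \sum_(y : T) 2 = #|T| * 2 by rewrite sum_nat_const.
have ind u : \sum_(z : T) (z == u : nat) = 1.
  by rewrite (bigD1 u) //= eqxx big1 // => z /negPf->.
have [v /andP[vx v1]|no1] := pickP (fun v => (v != x) && (deg e v <= 1)).
  exists v; split=> [|y yv]; first by have := d_gt0 v; lia.
  rewrite ltnNge; apply/negP => y1.
  have yx : y != x by apply: contraTneq y1 => ->; rewrite dx.
  have : \sum_z (deg e z + ((z == v) + (z == y))) <= \sum_z (2 + (z == x)).
    apply: leq_sum => z _; have [->|zx] := eqVneq z x.
      by rewrite dx ![x == _]eq_sym (negPf vx) (negPf yx).
    have [->|zv] := eqVneq z v; first by rewrite eq_sym (negPf yv) !addn0 addn1.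
    by have [->|zy] := eqVneq z y; rewrite !addn0 ?addn1 // dO.
  by rewrite !big_split /= hs c2 !ind; move: nm; rewrite -leq_double; lia.
have : \sum_z deg e z = \sum_z (2 + (z == x)).
  apply: eq_bigr => z _; have [->|zx] := eqVneq z x; first by rewrite dx.
  apply/eqP; rewrite eqn_leq dO //= addn0.
  by have := no1 z; rewrite zx /=; lia.
by rewrite big_split /= hs c2 ind; lia.
Qed.

Lemma longest_path {T : finType} (e : rel T) v :
  exists s, [/\ path e v s, uniq (v :: s) & forall y, e (last v s) y -> y \in v :: s].
Proof.
pose P m := [exists t : m.-tuple T, path e v t && uniq (v :: t)].
have exP : exists m, P m by exists 0; apply/existsP; exists [tuple].
have leP m : P m -> m <= #|T|.
  case/existsP => t /andP[_ /card_uniqP]; rewrite /= size_tuple => E.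
  by apply: ltnW; rewrite -E max_card.
case: (ex_maxnP exP leP) => m /existsP[t /andP[pt ut]] max_m.
exists t; split=> // y ey; apply/negPn/negP => yt.
have : P m.+1.
  apply/existsP; exists [tuple of rcons t y]; rewrite rcons_path pt ey.
  by rewrite -rcons_cons rcons_uniq yt.
by move/max_m; rewrite ltnn.
Qed.

Lemma exists_lasso {T : finType} (e : rel T) n x :
  symmetric e -> irreflexive e -> connected e -> #|T| = n -> n <= #|edges e| ->
  deg e x = 3 -> (forall z, z != x -> deg e z <= 2) ->
  exists k w, [/\ 0 < k, k + 3 <= n & lasso e n k w].
Proof.
move=> e_sym e_irr e_conn cT nm dx dO.
have [|v [dv dge2]] := deg_exists_leaf e x e_sym e_irr e_conn _ dx dO.
  by rewrite cT.
have [s [pts us maxs]] := longest_path e v.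
pose p := v :: s; pose w a := nth v p a; pose l := size s.
have step a : a < l -> e (w a) (w a.+1) by move=> al; apply: (pathP v pts).
have w_inj a b : a <= l -> b <= l -> w a = w b -> a = b.
  by move=> al bl /eqP; rewrite nth_uniq // => /eqP.
have w0 : w 0 = v by [].
have wl : w l = last v s by rewrite /w /p /l -last_nth.
have in_w y : y \in p -> exists2 a, a <= l & y = w a.
  by case/(nthP v) => a al <-; exists a.
have w_in a : a <= l -> w a \in p by move=> al; rewrite mem_nth.
clearbody w.
(* Once as many neighbours of [w a] are known as its degree allows, they are all of its
   neighbours. *)
have nbrs a (S : seq nat) : a <= l -> uniq S ->
    all (fun b => (b <= l) && e (w a) (w b)) S -> deg e (w a) <= size S ->
    forall y, e (w a) y = (y \in map w S).
  move=> al uS /allP hS dS y.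
  have uw : uniq (map w S).
    rewrite map_inj_in_uniq // => b c /hS/andP[bl _] /hS/andP[cl _].
    exact: w_inj.
  have sub : {subset map w S <= enum [set z | e (w a) z]}.
    by move=> _ /mapP[b /hS/andP[_ eb] ->]; rewrite mem_enum inE.
  have [|_ ->] := uniq_min_size uw sub.
    by rewrite size_map -cardE.
  by rewrite mem_enum inE.
have l_gt0 : 0 < l.
  have /card_gt0P[y] : 0 < deg e v by rewrite dv.
  rewrite inE => evy; rewrite lt0n; apply/eqP => l0.
  have s0 : s = [::] by apply: size0nil.
  by have := maxs y; rewrite s0 /= inE => /(_ evy)/eqP yv; rewrite yv e_irr in evy.
have wl_v : w l != v.
  by rewrite -w0; apply/eqP => /w_inj; lia.
(* The last vertex has a second neighbour on the path: this closes the cycle. *)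
have [k [k0 kl ekl]] : exists k, [/\ 0 < k, k.+1 < l & e (w l) (w k)].
  have : 1 < #|[set y | e (w l) y]| by apply: dge2.
  case/card_gt1P => y [z []]; rewrite !inE => ely elz yz.
  have [a [al ela al1]] : exists a, [/\ a <= l, e (w l) (w a) & a != l.-1].
    have [|a al ya] := in_w y; first by apply: maxs; rewrite -wl.
    have [|b bl zb] := in_w z; first by apply: maxs; rewrite -wl.
    have [al1|] := eqVneq a l.-1; last by exists a; rewrite -ya.
    exists b; rewrite -zb; split=> //; apply: contraNneq yz => bl1.
    by rewrite ya zb al1 bl1.
  have al2 : a != l by apply: contraTneq ela => ->; rewrite e_irr.
  exists a; split=> //; last by lia.
  (* The leaf [w 0] has [w 1] as its only neighbour, so [a = 0] would give [l = 1], against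
     [a != l.-1]. *)
  rewrite lt0n; apply/eqP => a0; rewrite a0 in ela al1.
  have : w l \in map w [:: 1].
    by rewrite -(nbrs 0) ?(e_sym (w 0)) //= ?l_gt0 ?step // w0 dv.
  by rewrite inE => /eqP/w_inj; lia.
(* [w k] is adjacent to [w k.-1], [w k.+1] and [w l], which is possible only at the vertex of degree
   above 2. *)
have wk : w k = x.
  apply/eqP; apply: contraTT isT => /dO dk.
  have ep : e (w k) (w k.-1) by rewrite e_sym -{2}(prednK k0) step //; lia.
  have : w l \in map w [:: k.-1; k.+1].
    rewrite -(nbrs k) ?(e_sym (w k)) //= ?inE ?ep ?step //; lia.
  by rewrite !inE => /orP[/eqP/w_inj|/eqP/w_inj]; lia.
have nb a : a <= l -> forall y, e (w a) y = (y \in map w (lasso_nbrs l.+1 k a)).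
  move=> al; apply: nbrs => //; rewrite /lasso_nbrs.
  - by do ?[case: ifP => /= ?]; rewrite ?inE; lia.
  - case: eqP => [->|/= a0] /=; first by rewrite l_gt0 step.
    have ep : e (w a) (w a.-1).
      by rewrite e_sym -{2}(prednK (n := a)) ?step //; lia.
    case: eqP => [ak|ak] /=.
      by rewrite -ak ep step ?ak; [rewrite e_sym ekl; lia | lia].
    case: eqP => [al'|al'] /=; first by move: ep; rewrite al' => ->; rewrite ekl; lia.
    by rewrite ep step; lia.
  - case: eqP => [->|_]; first by rewrite w0 dv.
    case: eqP => [->|/eqP ak]; first by rewrite wk dx.
    have wax : w a != x.
      by rewrite -wk; apply: contra ak => /eqP/w_inj ->; lia.
    by case: ifP => _; apply: dO.
have lt_nbrs a b : a <= l -> b \in lasso_nbrs l.+1 k a -> b <= l.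
  by rewrite /lasso_nbrs; do ?[case: ifP => /= ?]; rewrite !inE; lia.
(* The degrees are exhausted along the path, so no edge leaves it; by connectedness the path is
   Hamiltonian. *)
have pT : [set y in p] = setT.
  apply: (connected_closed e e_conn _ v); first by rewrite !inE eqxx.
  move=> a b; rewrite !inE => /in_w[c cl ->]; rewrite nb // => /mapP[d /lt_nbrs dl ->].
  exact/w_in/dl.
have nl : n = l.+1.
  by rewrite -cT -cardsT -pT cardsE; apply/card_uniqP.
exists k, w; split=> //; first by lia.
split=> [a b|y|a b]; rewrite ?nl.
- rewrite !inE; exact: w_inj.
- by have [|a al ->] := in_w y; [have := in_setT y; rewrite -pT inE | exists a].
- rewrite !inE => al bl; rewrite nb //; apply/mapP/idP => [[c cn /w_inj ->]|bn] //.
    exact: lt_nbrs cn.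
  by exists b.
Qed.

(** * Degrees and bridges of a lasso *)

Section Lasso.
Context {T : finType} (e : rel T) (n k : nat) (w : nat -> T).
Hypothesis e_lasso : lasso e n k w.
Hypotheses (k_gt0 : 0 < k) (k_le_n : k + 3 <= n).

Lemma lasso_nbrs_ltn a b : a < n -> b \in lasso_nbrs n k a -> b < n.
Proof. by rewrite /lasso_nbrs; do ?[case: ifP => /= ?]; rewrite !inE; lia. Qed.

Lemma lasso_nbrs_uniq a : uniq (lasso_nbrs n k a).
Proof. by rewrite /lasso_nbrs; do ?[case: ifP => /= ?]; rewrite ?inE; lia. Qed.

Lemma lasso_eq a b : a < n -> b < n -> (w a == w b) = (a == b).
Proof.
case: e_lasso => w_inj _ _ an bn; apply/eqP/eqP => [|-> //].
exact: w_inj.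
Qed.

Lemma lasso_deg a : a < n -> deg e (w a) = size (lasso_nbrs n k a).
Proof.
move=> an; have [w_inj w_surj w_e] := e_lasso.
rewrite -(size_map w); have /card_uniqP <- : uniq (map w (lasso_nbrs n k a)).
  rewrite map_inj_in_uniq ?lasso_nbrs_uniq // => b c.
  by move=> /(lasso_nbrs_ltn _ _ an) bn /(lasso_nbrs_ltn _ _ an) cn; apply: w_inj.
apply: eq_card => y; rewrite inE; have [b bn ->] := w_surj y.
rewrite w_e //; apply/idP/mapP => [bN|[c cN /eqP]]; first by exists b.
by rewrite lasso_eq // ?(lasso_nbrs_ltn _ _ an cN) // => /eqP->.
Qed.

Hypothesis e_sym : symmetric e.

Lemma lasso_step a : a.+1 < n -> e (w a) (w a.+1).
Proof.
case: e_lasso => _ _ w_e an; rewrite w_e ?inE //; last by lia.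
by rewrite /lasso_nbrs; do ?[case: ifP => /= ?]; rewrite !inE; lia.
Qed.

Lemma lasso_close : e (w k) (w n.-1).
Proof.
case: e_lasso => _ _ w_e; rewrite w_e ?inE //; try lia.
by rewrite /lasso_nbrs; do ?[case: ifP => /= ?]; rewrite !inE; lia.
Qed.

Lemma lasso_edges A : A \in edges e ->
  (exists2 c, c.+1 < n & A = [set w c; w c.+1]) \/ A = [set w k; w n.-1].
Proof.
have [_ w_surj w_e] := e_lasso.
case/edgesP => x [y [exy ->]]; have [a an xa] := w_surj x; have [b bn yb] := w_surj y.
move: exy; rewrite xa yb w_e ?inE // => ab.
have : [\/ b = a.+1, a = b.+1, a = k /\ b = n.-1 | b = k /\ a = n.-1].
  move: ab; rewrite /lasso_nbrs; do ?[case: ifP => /= ?]; rewrite !inE => ?.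
  - by constructor 1; lia.
  - have [?|[?|?]] : b = k.-1 \/ b = k.+1 \/ b = n.-1 by lia.
    + by constructor 2; lia.
    + by constructor 1; lia.
    + by constructor 3; lia.
  - have [?|?] : b = n.-2 \/ b = k by lia.
    + by constructor 2; lia.
    + by constructor 4; lia.
  - have [?|?] : b = a.-1 \/ b = a.+1 by lia.
    + by constructor 2; lia.
    + by constructor 1; lia.
case=> [E|E|[-> ->]|[-> ->]].
- by left; exists a; rewrite -?E.
- by left; exists b; rewrite -?E // setUC.
- by right.
- by right; rewrite setUC.
Qed.

(** Without this edge, the set [S] of [w 0], ..., [w c] is closed under adjacency but misses
    [w c.+1]. *)
Lemma lasso_bridge_tail c : c < k -> [set w c; w c.+1] \in bridges e.
Proof.
move=> ck; rewrite inE mem_edges /=; last by apply: lasso_step; lia.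
have [_ w_surj w_e] := e_lasso; set A := [set w c; _]; apply/negP => f_conn.
pose S := [set w i | i : 'I_c.+1].
have in_S a : a < n -> (w a \in S) = (a <= c).
  move=> an; apply/imsetP/idP => [[i _ /eqP]|ac].
    by have ilt := ltn_ord i; rewrite lasso_eq //; lia.
  by exists (Ordinal (ac : a < c.+1)).
have ST : S = setT.
  apply: (connected_closed (del_edge e A) f_conn S (w 0)); first by rewrite in_S; lia.
  move=> x y; have [a an ->] := w_surj x; have [b bn ->] := w_surj y.
  rewrite !in_S // /del_edge /= w_e ?inE // eq_set2 !lasso_eq //; try lia.
  move=> ac /andP[]; rewrite /lasso_nbrs.
  by do ?[case: ifP => /= ?]; rewrite !inE; lia.
by have := in_S c.+1; rewrite ST inE; lia.
Qed.

(** After the deletion, [w 0] still reaches every index up to [c] along the path. Since [k <= c], it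
    passes from [w k] over the closing edge to [w n.-1] and walks back to the indices beyond [c];
    for [c = n.-1] there are none. *)
Lemma lasso_cycle_not_bridge c A : k <= c < n ->
  A = (if c == n.-1 then [set w k; w n.-1] else [set w c; w c.+1]) ->
  A \notin bridges e.
Proof.
move=> kc eA; rewrite inE negb_and negbK; apply/orP; right.
have [_ w_surj _] := e_lasso; pose f := del_edge e A.
have csym : connect_sym f by apply/sym_connect_sym/del_edge_sym.
have f_step a : a.+1 < n -> a != c -> f (w a) (w a.+1).
  move=> an ac; rewrite /f /del_edge /= lasso_step //= eA.
  by case: ifP => ?; rewrite eq_set2 !lasso_eq; lia.
have to0 a : a <= c -> connect f (w 0) (w a).
  elim: a => // a IHa ac; apply: connect_trans (IHa (ltnW ac)) (connect1 _).
  by apply: f_step; lia.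
have to_last d : c < n.-1 - d -> connect f (w (n.-1 - d)) (w n.-1).
  elim: d => [|d IHd] cd; first by rewrite subn0.
  apply: connect_trans (IHd _); last by lia.
  have -> : n.-1 - d = (n.-1 - d.+1).+1 by lia.
  by apply/connect1/f_step; lia.
have all0 y : connect f (w 0) y.
  have [a an ->] := w_surj y; have [ac|ca] := leqP a c; first exact: to0.
  apply: (@connect_trans _ _ (w n.-1)).
    apply: (@connect_trans _ _ (w k)); first by apply: to0; lia.
    apply/connect1; rewrite /f /del_edge /= lasso_close /= eA ifF; last by lia.
    by rewrite eq_set2 !lasso_eq; lia.
  have := to_last (n.-1 - a); rewrite csym.
  have -> : n.-1 - (n.-1 - a) = a by lia.
  by apply.
apply/forallP => x; apply/forallP => y.
by apply: connect_trans (all0 y); move: (all0 x); rewrite csym.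
Qed.

Lemma lasso_card_bridges : #|bridges e| = k.
Proof.
pose A (j : 'I_k) := [set w j; w j.+1].
have A_inj : injective A.
  move=> i j /eqP; have ik := ltn_ord i; have jk := ltn_ord j.
  rewrite /A eq_set2 !lasso_eq; try lia.
  by move=> ij; apply: val_inj => /=; lia.
rewrite -[RHS]card_ord -(card_imset _ A_inj); apply: eq_card => B.
apply/idP/imsetP => [Bb|[j _ ->]]; last exact: lasso_bridge_tail.
have : B \in edges e by move: Bb; rewrite inE => /andP[].
case/lasso_edges => [[c cn eB]|eB].
  have [ck|kc] := ltnP c k; first by exists (Ordinal ck).
  suff /negP : B \notin bridges e by []; apply: (lasso_cycle_not_bridge c); first by lia.
  by rewrite ifF //; lia.
suff /negP : B \notin bridges e by []; apply: (lasso_cycle_not_bridge n.-1); first by lia.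
by rewrite eqxx.
Qed.

Lemma lasso_index : exists i : T -> nat, forall y, i y < n /\ w (i y) = y.
Proof.
case: e_lasso => _ w_surj _; apply: (fin_all_exists (P := fun y a => a < n /\ w a = y)) => y.
by have [a an ->] := w_surj y; exists a.
Qed.

End Lasso.

(** Adjacency depends only on the indices, so matching the two numberings is an isomorphism. *)
Lemma lasso_iso {T U : finType} (e : rel T) (f : rel U) n k w w' :
  lasso e n k w -> lasso f n k w' -> graph_iso e f.
Proof.
move=> e_lasso f_lasso; have [w_inj _ w_e] := e_lasso.
have [w_inj' _ w_f] := f_lasso.
have [i iP] := lasso_index e n k w e_lasso.
have [j jP] := lasso_index f n k w' f_lasso.
exists (w' \o i).
  exists (w \o j) => x /=.
    have [ix wx] := iP x; have [jx wjx] := jP (w' (i x)).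
    by rewrite (w_inj' _ _ jx ix wjx).
  have [ix wx] := jP x; have [jx wjx] := iP (w (j x)).
  by rewrite (w_inj _ _ jx ix wjx).
move=> x y /=; have [ix wx] := iP x; have [iy wy] := iP y.
by rewrite w_f // -w_e // wx wy.
Qed.

Lemma graph_iso_lasso {T U : finType} (e : rel T) (f : rel U) n k w :
  graph_iso e f -> lasso f n k w -> exists w', lasso e n k w'.
Proof.
move=> [h [g hK gK] hf] [w_inj w_surj w_f]; exists (g \o w); split.
- by move=> a b an bn /= /(can_inj gK); apply: w_inj.
- by move=> y; have [a an E] := w_surj (h y); exists a; rewrite //= -E hK.
- by move=> a b an bn; rewrite -hf /= !gK w_f.
Qed.

(** * The graph [Pnk n k] as a lasso *)

Lemma Pnk_arcE n k i j : k + 3 <= n ->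
  Pnk_arc n k i j =
  [|| (i.+1 < n - k) && (j == i.+1), (i.+1 == n - k) && (j == 0),
      (j == n - k) && (i == 0) | (n - k < j) && (j == i.+1)].
Proof.
move=> kn; rewrite /Pnk_arc.
have [E|/eqP nE] := eqVneq i.+1 (n - k).
  by rewrite E modnn; case: ifP; lia.
have [lt|ge] := ltnP i (n - k); last by case: ifP; lia.
by rewrite modn_small; [case: ifP; lia | lia].
Qed.

Lemma Pnk_lasso n k : 0 < k -> k + 3 <= n -> exists w, lasso (@Pnk n k) n k w.
Proof.
move=> k0 kn; have n0 : 0 < n by lia.
(* The tail of [Pnk] is numbered away from the cycle, so it is read backwards, from the leaf [n.-1]
   down to [n - k]; then index [k] falls on vertex 0, which is [u_1]. *)
pose t a := if a < k then n.-1 - a else a - k.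
pose w a : 'I_n := insubd (Ordinal n0) (t a).
have t_lt a : a < n -> t a < n by rewrite /t; case: ifP; lia.
have wE a : a < n -> w a = t a :> nat by move=> an; rewrite val_insubd t_lt.
exists w; split.
- move=> a b; rewrite !inE => an bn /(congr1 val) /=; rewrite !wE // /t.
  by do 2![case: ifP]; lia.
- move=> i; have := ltn_ord i => ilt.
  exists (if i < n - k then i + k else n.-1 - i); first by case: ifP; lia.
  apply: val_inj; rewrite /= wE; last by case: ifP; lia.
  by rewrite /t; do 2![case: ifP]; lia.
- have arcE a b : a < n -> b < n -> Pnk_arc n k (w a) (w b) =
      [|| (k <= a) && (b == a.+1), (a == n.-1) && (b == k) | (a <= k) && (a == b.+1)].
    move=> an bn; rewrite Pnk_arcE // !wE // /t {wE t_lt w}.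
    by case: (ltnP a k) => ak; case: (ltnP b k) => bk; apply/idP/idP; lia.
  move=> a b; rewrite !inE => an bn; rewrite /Pnk /= !arcE //.
  rewrite /lasso_nbrs {arcE wE t_lt w t}.
  by do ?[case: ifP => /= ?]; rewrite !inE; apply/idP/idP; lia.
Qed.

(** * Graphs with a given number of bridges *)

Local Open Scope ring_scope.

Theorem theorem4p3 (R : rcfType) (n k : nat) (T : finType) (e : rel T)
  (e_sym : symmetric e) (e_irr : irreflexive e)
  (two_le_k : (2 <= k)%N) (k_le_n : (k + 3 <= n)%N)
  (card_T : #|T| = n) (e_conn : connected e)
  (card_bridges : #|bridges e| = k) :
  2 * (n%:R - 4) * Num.sqrt 2 + Num.sqrt 5 + 3 * Num.sqrt 13 <= sombor R e
  /\ (sombor R e = 2 * (n%:R - 4) * Num.sqrt 2 + Num.sqrt 5 + 3 * Num.sqrt 13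
      <-> graph_iso e (@Pnk n k)).
Proof.
have [A Ab] : exists A, A \in bridges e.
  by apply/card_gt0P; rewrite card_bridges (leq_trans _ two_le_k).
have nm : (n <= #|edges e|)%N.
  by rewrite -card_T card_edges_ge // card_bridges card_T; clear -k_le_n; lia.
have [||x x3] := exists_deg_ge3 e e_sym e_irr e_conn; first by rewrite card_T.
  by apply/set0Pn; exists A.
have k_gt0 : (0 < k)%N by exact: ltnW.
have bound y := sombor_bound R e e_sym e_irr e_conn n _ y card_T erefl nm.
have [le_v eq_v] := bound x x3.
split=> //; split=> [/eq_v[dx _ dO]|iso].
  have [k' [w [k'0 k'n e_lasso]]] := exists_lasso e n x e_sym e_irr e_conn card_T nm dx dO.
  (* The tail length of the lasso is its number of bridges. *)
  have k'E : k' = k.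
    by rewrite -card_bridges (lasso_card_bridges e n k' w e_lasso).
  have [w' P_lasso] := Pnk_lasso n k k_gt0 k_le_n.
  by rewrite k'E in e_lasso; apply: lasso_iso e_lasso P_lasso.
have [w' P_lasso] := Pnk_lasso n k k_gt0 k_le_n.
have [w e_lasso] := graph_iso_lasso _ _ _ _ _ iso P_lasso.
have [_ w_surj w_e] := e_lasso.
have dw := lasso_deg e n k w e_lasso k_gt0 k_le_n.
have kn : (k < n)%N by clear -k_le_n; lia.
have dk : deg e (w k) = 3%N by rewrite dw // /lasso_nbrs (gtn_eqF k_gt0) eqxx.
have wk3 : (2 < deg e (w k))%N by rewrite dk.
apply: (proj2 (proj2 (bound (w k) wk3))); split=> // [y|z zk].
  have [a an ->] := w_surj y; rewrite w_e ?inE // dw //.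
  (* Here [2 <= k] matters: the tail neighbour [w k.-1] is not the leaf [w 0], so it has degree
     2. *)
  clear -two_le_k k_le_n an; rewrite /lasso_nbrs eqxx ifF; last by lia.
  by rewrite !inE => ?; do ?[case: ifP => ?] => //=; lia.
have [a an za] := w_surj z; rewrite za dw //.
have ak : a != k by apply: contraNneq zk => <-; rewrite za.
by rewrite /lasso_nbrs (negPf ak); do ?[case: ifP].
Qed.
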